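(* Let $z_*=x_*+iy_*\in\mathbb{C}$ with $x_*,y_*\in\mathbb{R}$ and let $R>0$. If $0\in S(z_*,R)$, then $\iota(B(z_*,R))$ is the open half-plane consisting of all $x+iy$ ($x,y\in\mathbb{R}$) satisfying $$x_*x - y_*y > \frac{1}{2}.$$
   Context: $\overline{\mathbb{C}}=\mathbb{C}\cup\{\infty\}$ is the Riemann sphere and $\iota:\overline{\mathbb{C}}\to\overline{\mathbb{C}}$ is the inversion $\iota(z)=z^{-1}$ with $\iota(0)=\infty$ and $\iota(\infty)=0$. $B(z_*,R)=\{z\in\mathbb{C}:|z-z_*|<R\}$ and $S(z_*,R)=\{z\in\mathbb{C}:|z-z_*|=R\}$. *)

(* Defs.v *)
(* The real numbers are an arbitrary R : realType, the complex numbers R[i]. *)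
From mathcomp Require Import all_boot all_order all_algebra complex.
From mathcomp Require Import classical_sets reals topology.

Set Implicit Arguments.
Unset Strict Implicit.
Unset Printing Implicit Defensive.

Import Order.TTheory GRing.Theory Num.Theory.

Local Open Scope classical_set_scope.
Local Open Scope ring_scope.
Local Open Scope complex_scope.

(* The point at infinity is None; a finite point z is Some z. *)
Definition riemann_sphere (R : realType) : Type :=
  one_point_compactification R[i].

Definition finite_part (R : realType) (A : set R[i]) : set (riemann_sphere R) :=
  [set (Some z : riemann_sphere R) | z in A].

Definition inversion (R : realType) (p : riemann_sphere R) : riemann_sphere R :=
  match p with
  | Some z => if z == 0 then None else Some z^-1
  | None => Some 0
  end.

(* The norm of R[i] takes its values in R[i] (they are real), hence the
   embedding r%:C of the radius. *)
Definition cball (R : realType) (c : R[i]) (r : R) : set R[i] :=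
  [set z | `|z - c| < r%:C].

Definition csphere (R : realType) (c : R[i]) (r : R) : set R[i] :=
  [set z | `|z - c| = r%:C].

Definition open_half_plane (R : realType) (H : set R[i]) : Prop :=
  exists a b c : R, (a, b) <> (0, 0) /\
    H = [set z | c < a * complex.Re z + b * complex.Im z].

(* Main.v *)
(* Multiplying by |w|, the condition |1/w - c| < |c| becomes
   |1 - c w| < |c w|: the point c w is closer to 1 than to 0, that is,
   Re (c w) > 1/2. With c = x_* + i y_* and w = x + i y,
   Re (c w) = x_* x - y_* y. *)
Require Import Defs.
From mathcomp Require Import all_boot all_order all_algebra complex.
From mathcomp Require Import classical_sets reals topology.
From mathcomp Require Import lra.

Set Implicit Arguments.
Unset Strict Implicit.
Unset Printing Implicit Defensive.

Import Order.TTheory GRing.Theory Num.Theory.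

Local Open Scope classical_set_scope.
Local Open Scope ring_scope.
Local Open Scope complex_scope.

(** Both norms are nonnegative, so they may be squared, and [|1 - u|^2 - |u|^2 = 1 - 2 Re u]. *)
Lemma lt_normc_sub1 (R : realType) (u : R[i]) :
  (`|1 - u| < `|u|) = (1 / 2 < complex.Re u).
Proof.
case: u => a b; rewrite !normc_def ltcR /= sub0r sqrrN.
rewrite -[LHS]ltr_sqr ?nnegrE ?sqrtr_ge0 // !sqr_sqrtr ?addr_ge0 ?sqr_ge0 //.
by apply/idP/idP => ?; nra.
Qed.

Lemma cball_invE (R : realType) (c w : R[i]) (r : R) : csphere c r 0 ->
  w != 0 -> cball c r w^-1 <-> 1 / 2 < complex.Re (c * w).
Proof.
(* Since 0 lies on the circle, the radius is [|c|]. *)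
rewrite /csphere /cball /= sub0r normrN => <- w0.
rewrite -lt_normc_sub1 -(ltr_pM2r (_ : 0 < `|w|)) ?normr_gt0 //.
by rewrite -!normrM mulrBl mulVf.
Qed.

Theorem theorem5 (R : realType) (xs ys r : R) (hr : 0 < r)
    (h0 : csphere (xs +i* ys) r 0) :
  let H : set R[i] :=
    [set w | exists x y : R, w = x +i* y /\ xs * x - ys * y > 1 / 2] in
  open_half_plane H /\
  @inversion R @` finite_part (cball (xs +i* ys) r) = finite_part H.
Proof.
move=> H.
have HE w : H w <-> 1 / 2 < complex.Re ((xs +i* ys) * w).
  case: w => x y /=; split=> [[x' [y' [[-> ->]]]] //|xy_gt].
  by exists x, y.
have inv_ball w : w != 0 -> cball (xs +i* ys) r w^-1 <-> H w.
  by move=> w0; rewrite HE; exact: cball_invE.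
(* The ball is open and 0 lies on its boundary, so the image of the ball avoids the point at
   infinity. *)
have ball_neq0 z : cball (xs +i* ys) r z -> z != 0.
  by apply: contraPneq => ->; rewrite /cball /= h0 ltxx.
have H_neq0 w : H w -> w != 0.
  by apply: contraPneq => ->; rewrite HE mulr0 /=; lra.
split.
  exists xs, (- ys), (1 / 2); split.
    (* If the normal vector [(xs, - ys)] vanished, the centre would be 0, and a circle through its
       own centre has [r = 0]. *)
    case=> xs0 /eqP; rewrite oppr_eq0 => /eqP ys0.
    have := h0; rewrite /csphere /= xs0 ys0 subrr normr0 => -[r0].
    by rewrite -r0 ltxx in hr.
  by apply/seteqP; split=> -[x y]; rewrite HE /= mulNr.
apply/seteqP; split=> [_ [_ [z zB <-] <-]|_ [w wH <-]].
  have z0 := ball_neq0 _ zB; rewrite /= (negPf z0); exists z^-1 => //.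
  by apply/inv_ball; rewrite ?invr_eq0 // invrK.
(* Inversion is an involution, so [w^-1] is the preimage of [w]. *)
have w0 := H_neq0 _ wH; exists (Some w^-1).
  by exists w^-1 => //; apply/inv_ball.
by rewrite /= invr_eq0 (negPf w0) invrK.
Qed.
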